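(* Let $X$ be a finite set, $1\le K\le|X|$, and let $f:2^X\to\mathbb{R}$ be a polymatroid set function with total curvature $c\in(0,1]$ and total $k$-batch curvatures $\{c_k\}_{k=1}^K$. Then: (1) the harmonic bound $\frac{1}{1+c_k}$ is nondecreasing in $k$ for $1\le k\le K$; (2) the exponential bound is nondecreasing in $k$ over the batch sizes $k$ dividing $K$: if $1\le k_1\le k_2\le K$, $k_1$ and $k_2$ both divide $K$, and $c_{k_2}>0$, then $$\frac{1}{c_{k_1}}\left(1-\left(1-\frac{c_{k_1}}{K/k_1}\right)^{K/k_1}\right)\ \le\ \frac{1}{c_{k_2}}\left(1-\left(1-\frac{c_{k_2}}{K/k_2}\right)^{K/k_2}\right).$$
   Context: Polymatroid set function: $f:2^X\to\mathbb{R}$ with $f(\emptyset)=0$ that is nondecreasing ($f(A)\le f(B)$ for $A\subseteq B\subseteq X$) and submodular ($f(A\cup\{j\})-f(A)\ge f(B\cup\{j\})-f(B)$ for $A\subseteq B\subseteq X$, $j\in X\setminus B$). Notation: $\varrho_T(A)=f(A\cup T)-f(A)$ for $A,T\subseteq X$, and $\varrho_j=\varrho_{\{j\}}$. Total curvature: $c=\max_{j\in X^*}\left\{1-\frac{\varrho_j(X\setminus\{j\})}{\varrho_j(\emptyset)}\right\}$, where $X^*=\{j\in X:\varrho_j(\emptyset)\ne 0\}$. Total $k$-batch curvature: $c_k=\max_{I\in\hat X}\left\{1-\frac{\varrho_I(X\setminus I)}{\varrho_I(\emptyset)}\right\}$, where $\hat X=\{I\subseteq X:\varrho_I(\emptyset)\ne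 0,\ |I|=k\}$. The harmonic and exponential bounds are lower bounds for the ratio of the value of a $k$-batch greedy solution to the optimal value, for general matroids with maximal sets of cardinality $K$ and for the uniform matroid of rank $K$, respectively; only the displayed expressions matter here. *)

(* Defs.v *)
From mathcomp Require Import all_boot all_order all_algebra.
From mathcomp Require Import reals.

Set Implicit Arguments.
Unset Strict Implicit.
Unset Printing Implicit Defensive.

Import Order.TTheory GRing.Theory Num.Theory.
Local Open Scope ring_scope.

(* The junk value 0 is returned only when A is empty; finmaxP states that
   finmax A F is the maximum of F on A otherwise. *)
Definition finmax (R : realType) (T : finType) (A : {set T}) (F : T -> R) : R :=
  if [pick i in A] is Some i0 then F [arg max_(i > i0 in A) F i]%O else 0.

Lemma finmaxP (R : realType) (T : finType) (A : {set T}) (F : T -> R) :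
  A != set0 ->
  (exists2 i, i \in A & finmax A F = F i) /\
  (forall j, j \in A -> F j <= finmax A F).
Proof.
rewrite /finmax; case: pickP => [i0 i0A _|A0 /set0Pn[i]]; last by rewrite A0.
by case: arg_maxP => // i iA maxi; split=> //; exists i.
Qed.

(* marginal f T A is $\varrho_T(A)$: the increment set comes first. *)
Definition marginal (R : realType) (X : finType) (f : {set X} -> R)
  (T A : {set X}) : R := f (A :|: T) - f A.

Definition polymatroid (R : realType) (X : finType) (f : {set X} -> R) : Prop :=
  [/\ f set0 = 0,
      forall A B : {set X}, A \subset B -> f A <= f B &
      forall (A B : {set X}) (j : X), A \subset B -> j \notin B ->
        f (j |: B) - f B <= f (j |: A) - f A].

Definition total_curvature (R : realType) (X : finType) (f : {set X} -> R) : R :=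
  finmax [set j : X | marginal f [set j] set0 != 0]
    (fun j => 1 - marginal f [set j] (~: [set j]) / marginal f [set j] set0).

Definition batch_curvature (R : realType) (X : finType) (f : {set X} -> R)
  (k : nat) : R :=
  finmax [set I : {set X} | (marginal f I set0 != 0) && (#|I| == k)]
    (fun I => 1 - marginal f I (~: I) / marginal f I set0).

(* Main.v *)
Require Import Defs.
From mathcomp Require Import all_boot all_order all_algebra.
From mathcomp Require Import reals.
From mathcomp Require Import ring lra.

Set Implicit Arguments.
Unset Strict Implicit.
Unset Printing Implicit Defensive.

Import Order.TTheory GRing.Theory Num.Theory.
Local Open Scope ring_scope.

(** Both bounds are nonincreasing in the curvature, so everything rests on
    [batch_curvature_antitone]: $c_k$ is nonincreasing in $k$.  For
    $0 \le m \le 1$, the inequality $c_k \le 1 - m$ says that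
    $m f(I) \le f(X) - f(X \setminus I)$ for all $I$ of size $k$, that is,
    $p(I) \le p(\emptyset)$ for the function
    $p(A) = f(X \setminus A) + m f(A)$.  This $p$ is submodular, although it
    need not be monotone, and for a submodular function such a bound on all sets
    of size $k \ge 1$ propagates to all larger sets ([le_set0_larger]), by
    averaging over the sets obtained by deleting one point ([deletion_sum]).
    It is applied with $m = 1 - c_k$, which is nonnegative because $f$ is
    monotone; with $I = X$ it also gives $c_k \ge 0$, which keeps the
    denominator $1 + c_k$ positive.

    The exponential bound is $\phi_n(c) = \frac1c (1 - (1 - c/n)^n)$ with
    $n = K/k$, so that raising $k$ lowers both $c = c_k$ and $n$.  As a
    geometric sum, $\phi_n(c) = \frac1n \sum_{i<n} (1 - c/n)^i$ is
    nonincreasing in $c$ on $(0, 1]$ ([exp_bound_antitone_curvature]); it is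
    nonincreasing in $n$ because $(1 - c/n)^n$ is nondecreasing in $n$, an
    instance of the inequality between arithmetic and geometric means
    ([compound_le]). *)

(** * Submodular functions *)

Section Submodular.
Variables (R : realType) (X : finType).
Implicit Types (f g p : {set X} -> R) (A B I J : {set X}).

Definition submodular f : Prop :=
  forall A B (j : X), A \subset B -> j \notin B ->
    f (j |: B) - f B <= f (j |: A) - f A.

(** Complementation reverses inclusion and turns the insertion of a point into
    its deletion: the two sign changes cancel. *)
Lemma submodular_compl f : submodular f -> submodular (fun A => f (~: A)).
Proof.
move=> sub_f A B j sAB jNB.
have jNA : j \notin A by apply: contra jNB; apply: (subsetP sAB).
have delC (C : {set X}) : j \notin C -> ~: C = j |: ~: (j |: C).
  move=> jNC; apply/setP=> x; rewrite !inE negb_or.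
  by case: eqVneq => // ->; rewrite jNC.
have sC : ~: (j |: B) \subset ~: (j |: A) by rewrite setCS setUS.
have jN : j \notin ~: (j |: A) by rewrite !inE eqxx.
have := sub_f _ _ _ sC jN; rewrite -!delC //; lra.
Qed.

Lemma submodular_addZ f g m :
  0 <= m -> submodular f -> submodular g ->
  submodular (fun A => f A + m * g A).
Proof.
move=> m0 sub_f sub_g A B j sAB jNB.
have := sub_f _ _ _ sAB jNB.
have := ler_wpM2l m0 (sub_g _ _ _ sAB jNB); lra.
Qed.

(** Build up [J] one point at a time: by submodularity each point contributes
    at least its increment at the top of [I]. *)
Lemma sum_top_increments f I J : submodular f -> J \subset I ->
  \sum_(i in J) (f I - f (I :\ i)) <= f J - f set0.
Proof.
move=> sub_f; have [n] := ubnP #|J|; elim: n J => // n IHn J ltJn sJI.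
have [->|[j jJ]] := set_0Vmem J; first by rewrite big_set0 subrr.
have jI := subsetP sJI j jJ.
rewrite (big_setD1 j) //=.
have {}IHn : \sum_(i in J :\ j) (f I - f (I :\ i)) <= f (J :\ j) - f set0.
  apply: IHn; last exact: subset_trans (subsetDl _ _) sJI.
  by move: ltJn; rewrite (cardsD1 j) jJ.
have jN : j \notin I :\ j by rewrite !inE eqxx.
have := sub_f _ _ _ (setSD [set j] sJI) jN; rewrite !setD1K //; lra.
Qed.

Lemma deletion_sum f I : submodular f ->
  f set0 + #|I|%:R * f I <= f I + \sum_(i in I) f (I :\ i).
Proof.
move=> sub_f; have := sum_top_increments sub_f (subxx I).
rewrite sumrB sumr_const -mulr_natl; lra.
Qed.

(** If $|I| = k + 1$ then every deletion $I \setminus i$ has size $k$, and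
    [deletion_sum] gives $p(\emptyset) + k p(I) \le (k + 1) p(\emptyset)$; since
    $k$ is positive, it can be cancelled. *)
Lemma le_set0_larger p k l : submodular p -> (0 < k <= l)%N ->
  (forall J, #|J| = k -> p J <= p set0) ->
  forall I, #|I| = l -> p I <= p set0.
Proof.
move=> sub_p /andP[k_gt0 le_kl] p_k.
rewrite -(subnKC le_kl); elim: (l - k)%N => [|d IHd] I.
  by rewrite addn0; apply: p_k.
rewrite addnS => cardI.
have del_le i : i \in I -> p (I :\ i) <= p set0.
  by move=> iI; apply: IHd; move: cardI; rewrite (cardsD1 i) iI => -[].
have := deletion_sum I sub_p.
have : \sum_(i in I) p (I :\ i) <= \sum_(i in I) p set0 by apply: ler_sum.
rewrite sumr_const cardI -mulr_natl => sum_le del_sum.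
rewrite -(ler_pM2l (_ : 0 < (k + d)%:R)) ?ltr0n ?addn_gt0 ?k_gt0 //.
by move: sum_le del_sum; rewrite -natr1; lra.
Qed.

End Submodular.

(** * Batch curvatures *)

Section BatchCurvature.
Variables (R : realType) (X : finType) (f : {set X} -> R).
Hypothesis hf : polymatroid f.
Implicit Types (I J A : {set X}).

Lemma polymatroid_ge0 A : 0 <= f A.
Proof. by have [f0 mono _] := hf; rewrite -f0 mono ?sub0set. Qed.

Lemma marginal_set0 I : marginal f I set0 = f I.
Proof. by have [f0 _ _] := hf; rewrite /marginal set0U f0 subr0. Qed.

Lemma marginal_compl I : marginal f I (~: I) = f setT - f (~: I).
Proof. by rewrite /marginal setUC setUCr. Qed.

(** When $f(J) = 0$ the set [J] is excluded from the maximum that defines the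
    curvature, and the inequality is monotonicity of [f]. *)
Lemma batch_curvature_ub k J : #|J| = k ->
  f (~: J) + (1 - batch_curvature f k) * f J <= f setT.
Proof.
move=> cardJ; have [_ mono _] := hf.
have fC : f (~: J) <= f setT by rewrite mono ?subsetT.
have [->|fJ_neq0] := eqVneq (f J) 0; first by rewrite mulr0 addr0.
have fJ_gt0 : 0 < f J by rewrite lt_neqAle eq_sym fJ_neq0 polymatroid_ge0.
rewrite /batch_curvature.
set S := [set I : {set X} | _]; set F := fun I : {set X} => _ - _ / _.
have JS : J \in S by rewrite inE marginal_set0 fJ_neq0 cardJ eqxx.
have /(finmaxP F)[_ /(_ J JS)] : S != set0 by apply/set0Pn; exists J.
rewrite /F marginal_set0 marginal_compl => le_c.
have : 1 - finmax S F <= (f setT - f (~: J)) / f J by lra.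
by rewrite ler_pdivlMr //; lra.
Qed.

(** The hypothesis $c \ge 0$ covers the case where all sets of size [k] have
    value $0$: the curvature is then $0$ by convention. *)
Lemma batch_curvature_le k c : 0 <= c ->
  (forall I, #|I| = k -> f (~: I) + (1 - c) * f I <= f setT) ->
  batch_curvature f k <= c.
Proof.
move=> c0 ub_c; rewrite /batch_curvature.
set S := [set I : {set X} | _]; set F := fun I : {set X} => _ - _ / _.
have [S0|S_neq0] := eqVneq S set0.
  by rewrite /finmax; case: pickP => // i; rewrite S0 inE.
have [[I + ->] _] := finmaxP F S_neq0.
rewrite inE marginal_set0 => /andP[fI_neq0 /eqP cardI].
have fI_gt0 : 0 < f I by rewrite lt_neqAle eq_sym fI_neq0 polymatroid_ge0.
rewrite /F marginal_set0 marginal_compl.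
suff : 1 - c <= (f setT - f (~: I)) / f I by lra.
by rewrite ler_pdivlMr //; have := ub_c I cardI; lra.
Qed.

Lemma batch_curvature_le1 k : batch_curvature f k <= 1.
Proof.
have [_ mono _] := hf; apply: batch_curvature_le => // I _.
by rewrite subrr mul0r addr0 mono ?subsetT.
Qed.

(** The function [p] below has $p(\emptyset) = f(X)$, so [batch_curvature_ub]
    is the bound that [le_set0_larger] propagates. *)
Lemma batch_curvature_ub_larger k I : (0 < k <= #|I|)%N ->
  f (~: I) + (1 - batch_curvature f k) * f I <= f setT.
Proof.
move=> le_kI; have [f0 _ sub_f] := hf.
pose p A := f (~: A) + (1 - batch_curvature f k) * f A.
have sub_p : submodular p.
  apply: (submodular_addZ _ (submodular_compl sub_f) sub_f).
  by rewrite subr_ge0 batch_curvature_le1.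
have p0 : p set0 = f setT by rewrite /p setC0 f0 mulr0 addr0.
rewrite -p0; apply: (le_set0_larger sub_p le_kI) => // J cardJ.
by rewrite p0; apply: batch_curvature_ub.
Qed.

(** Taking the whole ground set as the larger set gives
    $(1 - c_k) f(X) \le f(X)$. *)
Lemma batch_curvature_ge0 k : (0 < k <= #|X|)%N -> 0 <= batch_curvature f k.
Proof.
move=> le_kX; have [f0 mono _] := hf.
have le_kT : (0 < k <= #|[set: X]|)%N by rewrite cardsT.
have := batch_curvature_ub_larger le_kT; rewrite setCT f0 add0r.
have [fT0 _|fT_neq0] := eqVneq (f setT) 0.
  rewrite /batch_curvature /finmax; case: pickP => // I.
  rewrite inE marginal_set0 => /andP[/eqP[]]; apply/eqP.
  by rewrite eq_le polymatroid_ge0 -fT0 mono ?subsetT.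
have fT_gt0 : 0 < f setT by rewrite lt_neqAle eq_sym fT_neq0 polymatroid_ge0.
by rewrite ger_pMl //; lra.
Qed.

Lemma batch_curvature_antitone k l : (0 < k <= l)%N -> (k <= #|X|)%N ->
  batch_curvature f l <= batch_curvature f k.
Proof.
move=> /andP[k_gt0 le_kl] le_kX.
apply: batch_curvature_le => [|I cardI].
  by apply: batch_curvature_ge0; rewrite k_gt0.
by apply: batch_curvature_ub_larger; rewrite k_gt0 cardI.
Qed.

End BatchCurvature.

(** * The exponential bound *)

Section ExponentialBound.
Variable R : realType.
Implicit Types (c d : R) (n m : nat).

Definition exp_bound n c : R := c^-1 * (1 - (1 - c / n%:R) ^+ n).

Lemma exp_bound_geometric n c : (0 < n)%N -> c != 0 ->
  exp_bound n c = n%:R^-1 * \sum_(i < n) (1 - c / n%:R) ^+ i.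
Proof.
move=> n_gt0 c_neq0; have n_neq0 : n%:R != 0 :> R by rewrite pnatr_eq0 -lt0n.
rewrite /exp_bound -opprB subrX1.
by field; rewrite n_neq0.
Qed.

Lemma exp_base_ge0 n c : (0 < n)%N -> c <= 1 -> 0 <= 1 - c / n%:R.
Proof.
move=> n_gt0 c1; rewrite subr_ge0 ler_pdivrMr ?ltr0n // mul1r.
by apply: le_trans c1 _; rewrite ler1n.
Qed.

Lemma exp_bound_antitone_curvature n c d : (0 < n)%N -> 0 < c -> c <= d ->
  d <= 1 -> exp_bound n d <= exp_bound n c.
Proof.
move=> n_gt0 c_gt0 le_cd d1; have d_gt0 := lt_le_trans c_gt0 le_cd.
rewrite !exp_bound_geometric ?gt_eqF // ler_wpM2l ?invr_ge0 ?ler0n //.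
apply: ler_sum => i _; apply: lerXn2r; rewrite ?nnegrE ?exp_base_ge0 //.
  exact: le_trans d1.
by rewrite lerD2l lerN2 ler_wpM2r ?invr_ge0 ?ler0n.
Qed.

(** Apply the AM-GM inequality to $m$ numbers, of which $n$ equal $1 - c/n$ and
    the others equal $1$: their mean is $1 - c/m$. *)
Lemma compound_le n m c : (0 < n <= m)%N -> c <= 1 ->
  (1 - c / n%:R) ^+ n <= (1 - c / m%:R) ^+ m.
Proof.
move=> /andP[n_gt0 le_nm] c1; have m_gt0 := leq_trans n_gt0 le_nm.
have n_neq0 : n%:R != 0 :> R by rewrite pnatr_eq0 -lt0n.
have m_neq0 : m%:R != 0 :> R by rewrite pnatr_eq0 -lt0n.
pose E (i : 'I_n + 'I_(m - n)) := if i is inl _ then 1 - c / n%:R else 1.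
have E_ge0 : {in predT, forall i, 0 <= E i}.
  by case=> i _ /=; rewrite ?ler01 ?exp_base_ge0.
have := (leif_AGM E_ge0).1.
rewrite !big_sumType /= !prodr_const !sumr_const cardT -cardE card_sum !card_ord.
rewrite subnKC // expr1n mulr1 => /le_trans; apply.
rewrite le_eqVlt; apply/orP; left; apply/eqP; congr (_ ^+ _).
by rewrite -mulr_natl natrB //; field; rewrite m_neq0.
Qed.

Lemma exp_bound_antitone_steps n m c : (0 < n <= m)%N -> 0 < c -> c <= 1 ->
  exp_bound m c <= exp_bound n c.
Proof.
move=> le_nm c_gt0 c1.
by rewrite ler_wpM2l ?invr_ge0 ?(ltW c_gt0) // lerD2l lerN2 compound_le.
Qed.

End ExponentialBound.

Theorem mainTheorem4 (R : realType) (X : finType) (K : nat) (f : {set X} -> R)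
    (hK : (1 <= K <= #|X|)%N)
    (hf : polymatroid f)
    (hc : 0 < total_curvature f <= 1) :
  (forall k1 k2 : nat, (1 <= k1)%N -> (k1 <= k2)%N -> (k2 <= K)%N ->
     1 / (1 + batch_curvature f k1) <= 1 / (1 + batch_curvature f k2))
  /\
  (forall k1 k2 : nat, (1 <= k1)%N -> (k1 <= k2)%N -> (k2 <= K)%N ->
     (k1 %| K)%N -> (k2 %| K)%N -> 0 < batch_curvature f k2 ->
     1 / batch_curvature f k1 *
       (1 - (1 - batch_curvature f k1 / (K%:R / k1%:R)) ^+ (K %/ k1)%N)
     <= 1 / batch_curvature f k2 *
       (1 - (1 - batch_curvature f k2 / (K%:R / k2%:R)) ^+ (K %/ k2)%N)).
Proof.
case/andP: hK => _ le_KX.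
have antitone k l : (1 <= k)%N -> (k <= l)%N -> (l <= K)%N ->
    batch_curvature f l <= batch_curvature f k.
  move=> k_gt0 le_kl le_lK.
  apply: batch_curvature_antitone; rewrite ?k_gt0 //.
  exact: leq_trans (leq_trans le_kl le_lK) le_KX.
split=> k1 k2 k1_gt0 le_k le_k2K.
  have c2_ge0 : 0 <= batch_curvature f k2.
    apply: batch_curvature_ge0 => //.
    by rewrite (leq_trans k1_gt0) // (leq_trans le_k2K).
  have le_c := antitone _ _ k1_gt0 le_k le_k2K.
  by rewrite !div1r lef_pV2 ?posrE; lra.
move=> dvd1 dvd2 c2_gt0.
have k2_gt0 := leq_trans k1_gt0 le_k.
have le_c := antitone _ _ k1_gt0 le_k le_k2K.
have c1_gt0 := lt_le_trans c2_gt0 le_c.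
have steps_gt0 : (0 < K %/ k2)%N by rewrite divn_gt0.
have le_steps : (K %/ k2 <= K %/ k1)%N by apply: leq_div2l.
have quotR k : (0 < k)%N -> (k %| K)%N -> K%:R / k%:R = (K %/ k)%:R :> R.
  by move=> k_gt0 dvd; rewrite natf_div.
rewrite !quotR // !div1r.
apply: (le_trans (y := exp_bound (K %/ k2) (batch_curvature f k1))).
  apply: exp_bound_antitone_steps; rewrite ?steps_gt0 //.
  exact: batch_curvature_le1.
exact: exp_bound_antitone_curvature (batch_curvature_le1 hf _).
Qed.
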